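(* Let $k$ be an infinite field, let $S=\langle g_1,\dots,g_n\rangle$ be a numerical semigroup with smallest minimal generator $g_1$, and let $R=k[[t^S]]$. If the Hilbert function $H_R$ is decreasing (that is, $H_R(h-1)>H_R(h)$ for some $h\ge 1$), then there exists an index $j\ge 2$ such that $|C_h|\ge h+1$ for every integer $h$ with $2\le h\le j$.
   Context: A numerical semigroup $S$ is a subsemigroup of $(\mathbb{N},+)$ containing $0$; $S=\langle g_1,\dots,g_n\rangle$ means that $g_1<g_2<\dots<g_n$ is its minimal set of generators, and it is assumed that $\gcd(g_1,\dots,g_n)=1$ (equivalently $\mathbb{N}\setminus S$ is finite). Put $M=S\setminus\{0\}$, $0M=S$, and for $h\ge 1$ let $hM=\{m_1+\dots+m_h : m_1,\dots,m_h\in M\}$. For $h\ge 1$ define $$C_h=\{s\in hM\setminus (h+1)M : s-g_1\notin (h-1)M\setminus hM\}.$$ The semigroup ring is $R=k[[t^S]]=k[[t^{g_1},\dots,t^{g_n}]]$, a one-dimensional local domain with maximal ideal $\mathfrak{m}=(t^{g_1},\dots,t^{g_n})$. Its Hilbert function is $H_R(h)=\dim_k \mathfrak{m}^h/\mathfrak{m}^{h+1}$ for $h\ge 0$ (with $\mathfrak{m}^0=R$), and one has $H_R(h)=|hM\setminus (h+1)M|$ for all $h\ge 0$. ''Decreasing'' means ''not non-decreasing''. *)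

(* Defs.v *)
From HB Require Import structures.
From mathcomp Require Import all_boot all_order all_algebra.
From mathcomp Require Import boolp classical_sets cardinality.

Set Implicit Arguments.
Unset Strict Implicit.
Unset Printing Implicit Defensive.

Import GRing.Theory.

Local Open Scope ring_scope.

Record fps (K : Type) := FPS { fps_coef : nat -> K }.

HB.instance Definition _ (K : Type) := gen_eqMixin (fps K).
HB.instance Definition _ (K : Type) := gen_choiceMixin (fps K).

Lemma fpsP (K : Type) (f g : fps K) : fps_coef f =1 fps_coef g -> f = g.
Proof. by case: f g => [f] [g] /= /funext ->. Qed.

Section FpsZmodule.
Variable K : zmodType.
Implicit Types f g h : fps K.

Definition fps_zero : fps K := FPS (fun=> 0).
Definition fps_opp f := FPS (fun n => - fps_coef f n).
Definition fps_add f g := FPS (fun n => fps_coef f n + fps_coef g n).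

Fact fps_addA : associative fps_add.
Proof. by move=> f g h; apply: fpsP => n /=; rewrite addrA. Qed.
Fact fps_addC : commutative fps_add.
Proof. by move=> f g; apply: fpsP => n /=; rewrite addrC. Qed.
Fact fps_add0 : left_id fps_zero fps_add.
Proof. by move=> f; apply: fpsP => n /=; rewrite add0r. Qed.
Fact fps_addN : left_inverse fps_zero fps_opp fps_add.
Proof. by move=> f; apply: fpsP => n /=; rewrite addNr. Qed.

HB.instance Definition _ := GRing.isZmodule.Build (fps K)
  fps_addA fps_addC fps_add0 fps_addN.

End FpsZmodule.

Section FpsRing.
Variable K : comNzRingType.
Implicit Types f g h : fps K.

Definition fps_one : fps K := FPS (fun n => (n == 0%N)%:R).
Definition fps_mul f g :=
  FPS (fun n => \sum_(i < n.+1) fps_coef f i * fps_coef g (n - i)).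
Definition fps_scale (a : K) f := FPS (fun n => a * fps_coef f n).

Let trunc n f : {poly K} := \poly_(i < n) fps_coef f i.

Let trunc_mul n m f g : (n < m)%N ->
  fps_coef (fps_mul f g) n = (trunc m f * trunc m g)`_n.
Proof.
move=> ltnm; rewrite coefM /=; apply: eq_bigr => i _; rewrite !coef_poly.
have -> : (i < m)%N by apply: leq_ltn_trans ltnm; rewrite -ltnS.
by have -> : (n - i < m)%N by apply: leq_ltn_trans ltnm; exact: leq_subr.
Qed.

Fact fps_mulC : commutative fps_mul.
Proof.
by move=> f g; apply: fpsP => n; rewrite !(@trunc_mul n n.+1) // mulrC.
Qed.
Fact fps_mulA : associative fps_mul.
Proof.
move=> f g h; apply: fpsP => n /=.
transitivity (trunc n.+1 f * (trunc n.+1 g * trunc n.+1 h))`_n.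
  rewrite coefM; apply: eq_bigr => i _.
  rewrite -(@trunc_mul (n - i) n.+1) ?ltnS ?leq_subr //.
  by rewrite coef_poly ltn_ord.
rewrite mulrA coefM; apply: eq_bigr => i _.
rewrite -(@trunc_mul i n.+1) //.
by rewrite coef_poly ltnS leq_subr.
Qed.
Fact fps_mul1 : left_id fps_one fps_mul.
Proof.
move=> f; apply: fpsP => n /=; rewrite big_ord_recl big1 ?addr0 ?mul1r ?subn0 //.
by move=> i _ /=; rewrite mul0r.
Qed.
Fact fps_mulDl : left_distributive fps_mul +%R.
Proof.
move=> f g h; apply: fpsP => n /=; rewrite -big_split /=.
by apply: eq_bigr => i _; rewrite mulrDl.
Qed.
Fact fps_one_neq0 : fps_one != 0.
Proof.
by apply/eqP => /(congr1 (fun f => fps_coef f 0)) /eqP; rewrite /= oner_eq0.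
Qed.

HB.instance Definition _ := GRing.Zmodule_isComNzRing.Build (fps K)
  fps_mulA fps_mulC fps_mul1 fps_mulDl fps_one_neq0.

Fact fps_scaleA a b f :
  fps_scale a (fps_scale b f) = fps_scale (a * b) f.
Proof. by apply: fpsP => n /=; rewrite mulrA. Qed.
Fact fps_scale1 : left_id 1 fps_scale.
Proof. by move=> f; apply: fpsP => n /=; rewrite mul1r. Qed.
Fact fps_scaleDr : right_distributive fps_scale +%R.
Proof. by move=> a f g; apply: fpsP => n /=; rewrite mulrDr. Qed.
Fact fps_scaleDl f : {morph fps_scale^~ f : a b / a + b}.
Proof. by move=> a b; apply: fpsP => n /=; rewrite mulrDl. Qed.

HB.instance Definition _ := GRing.Zmodule_isLmodule.Build K (fps K)
  fps_scaleA fps_scale1 fps_scaleDr fps_scaleDl.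

Fact fps_scaleAl a f g : a *: (f * g) = (a *: f) * g.
Proof.
apply: fpsP => n /=; rewrite mulr_sumr.
by apply: eq_bigr => i _; rewrite mulrA.
Qed.

HB.instance Definition _ := GRing.Lmodule_isLalgebra.Build K (fps K)
  fps_scaleAl.
HB.instance Definition _ := GRing.Lalgebra_isComAlgebra.Build K (fps K).

Definition fps_monomial (s : nat) : fps K := FPS (fun n => (n == s)%:R).

End FpsRing.

Local Open Scope classical_set_scope.

(* Finiteness of the complement is not part of the structure: it is the
   condition gcd(g_1, ..., g_n) = 1 on the minimal generators. *)
Record semigroupN := SemigroupN {
  sgset :> set nat;
  sgset0 : sgset 0%N;
  sgsetD : forall s t, sgset s -> sgset t -> sgset (s + t)%N }.

Definition generated (g : seq nat) : set nat :=
  [set s | exists a : nat -> nat, s = (\sum_(i < size g) a i * nth 0 g i)%N].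

Definition minimal_generators (S : set nat) (g : seq nat) : Prop :=
  [/\ sorted ltn g, generated g = S &
      forall g', subseq g' g -> generated g' = S -> g' = g].

Definition gcd_seq (g : seq nat) : nat := (\big[gcdn/0]_(x <- g) x)%N.

Section Multiples.
Variable S : set nat.

Definition sgmax : set nat := S `\ 0%N.

(* hM *)
Definition sgmul (h : nat) : set nat :=
  if h is 0 then S
  else [set s | exists m : 'I_h -> nat,
                  (forall i, sgmax (m i)) /\ s = (\sum_i m i)%N].

(* C_h. The natural subtraction s - g1 is never truncated when g1 is the smallest
   generator and h >= 1, since then every element of hM is at least g1. *)
Definition sgC (g1 h : nat) : set nat :=
  [set s | (sgmul h `\` sgmul h.+1) s /\
           ~ (sgmul h.-1 `\` sgmul h) (s - g1)%N].

End Multiples.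

Section SemigroupRing.
Variables (K : fieldType) (S : semigroupN).

Definition supported_in : {pred fps K} :=
  fun f => `[< forall n, ~ sgset S n -> fps_coef f n = 0 >].

Fact supported_in_subalg : subalg_closed supported_in.
Proof.
split=> [|a f g /asboolP fS /asboolP gS|f g /asboolP fS /asboolP gS].
- apply/asboolP => -[|n] //= nS; case: nS; exact: sgset0.
- by apply/asboolP => n nS /=; rewrite fS // gS // mulr0 addr0.
apply/asboolP => n nS /=; apply: big1 => i _.
have [Si|/fS ->] := pselect (sgset S i); last by rewrite mul0r.
have [Sni|/gS ->] := pselect (sgset S (n - i)%N); last by rewrite mulr0.
by case: nS; rewrite -(@subnKC i n) -1?ltnS //; exact: sgsetD.
Qed.

HB.instance Definition _ :=
  GRing.isSubalgClosed.Build K (fps K) supported_in supported_in_subalg.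

(* k[[t^S]] : the power series whose exponents all lie in S. *)
Record sgring := Sgring {
  sgring_val :> fps K;
  sgring_valP : sgring_val \in supported_in }.

HB.instance Definition _ := [isSub for sgring_val].
HB.instance Definition _ := [Choice of sgring by <:].
HB.instance Definition _ := [SubChoice_isSubComNzRing of sgring by <:].
HB.instance Definition _ := [SubZmodule_isSubLmodule of sgring by <:].
HB.instance Definition _ := [SubNzRing_SubLmodule_isSubLalgebra of sgring by <:].
HB.instance Definition _ := [SubLalgebra_isSubAlgebra of sgring by <:].

End SemigroupRing.

Section Ideals.
Variable A : comNzRingType.

Definition ideal_gen (X : set A) : set A :=
  [set x | exists (n : nat) (r y : 'I_n -> A),
             (forall i, X (y i)) /\ x = \sum_i r i * y i].

Definition ideal_mul (I J : set A) : set A :=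
  ideal_gen [set z | exists x y, [/\ I x, J y & z = x * y]].

Definition ideal_pow (I : set A) (h : nat) : set A :=
  iter h (ideal_mul I) setT.

End Ideals.

Section QuotientDimension.
Variables (K : fieldType) (L : lmodType K).

(* The classes of b_0, ..., b_(d-1) modulo W form a basis of V/W. *)
Definition quot_basis (V W : set L) (d : nat) (b : 'I_d -> L) : Prop :=
  (forall i, V (b i)) /\
  (forall v, V v -> exists! c : {ffun 'I_d -> K}, W (v - \sum_i c i *: b i)).

(* dim V/W for subspaces W of V, with junk value 0 if it is infinite; the d
   below is unique by invariance of dimension. *)
Definition quot_dim (V W : set L) : nat :=
  xget 0%N [set d | exists b : 'I_d -> L, quot_basis V W b].

End QuotientDimension.

Section HilbertFunction.
Variables (K : fieldType) (S : semigroupN) (g : seq nat).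

(* The ideal (t^g_1, ..., t^g_n) of k[[t^S]]; when g generates S, each of
   these monomials does lie in k[[t^S]]. *)
Definition sgring_max : set (sgring K S) :=
  ideal_gen [set x | exists2 s, s \in g & sgring_val x = fps_monomial K s].

Definition hilbert (h : nat) : nat :=
  quot_dim (ideal_pow sgring_max h) (ideal_pow sgring_max h.+1).

End HilbertFunction.

(* Main.v *)
Require Import Defs.
From mathcomp Require Import all_boot all_order all_algebra.
From mathcomp Require Import boolp classical_sets cardinality.
From mathcomp Require Import zify.

(**
  The index [j = 2] suffices, so the claim is that [C_2] has at least three
  elements as soon as the Hilbert function drops somewhere. Contrapositively,
  if [C_2] has at most two elements, then each layer [hM \ (h+1)M] injects
  into the next one; since these layers index monomial bases of the quotients
  [m^h / m^(h+1)] ([hilbertE]), the Hilbert function is non-decreasing.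

  The obvious map [s |-> s + g1] sends a layer injectively into the next one,
  except at those [s] for which [s + g1] jumps to order at least [h + 2]. For
  such an [s] the sum [s + g1] lies in some [C_k] with [k >= h + 2]
  ([sgC_jump]), and the points of [C_(h+1)] are exactly the ones that the
  translation leaves free. So the jumping elements have to be matched
  injectively with points of [C_(h+1)].

  Algebraically [C_k] is the degree [k] monomial basis of the tangent cone
  modulo the initial form of [t^g1], and it behaves like the monomials of a
  standard graded algebra: any part of a decomposition of an element of [C_k]
  into [k] elements of [M] lies in the corresponding [C_h] ([sgC_part]). If
  there are at most two elements in degree 2, then comparing the pairwise sums
  of the summands shows that every element of degree [k >= 3] has the form
  [(k - 1) x + y] ([sgC_shape]). A jumping element with
  [s + g1 = (k - 1) x + y] is matched with [h x + y]. This is injective: the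
  value [h x + y] determines [x] ([sgC_base_inj]), hence [y], so two jumping
  elements with the same image differ by a multiple of [x]; but elements of one
  layer never differ by an element of [M] ([layer_incomparable]).
*)

Import GRing.Theory.

Local Open Scope classical_set_scope.
Local Open Scope card_scope.

(** * Sums of nonzero elements of a numerical semigroup *)

Definition layer (S : semigroupN) (h : nat) : set nat :=
  sgmul S h `\` sgmul S h.+1.

Section Powers.
Variable S : semigroupN.

(** Unlike the definition, which treats [0M = S] separately, this recursion is
    uniform in [h]: for [h = 0] it says [M + S = M]. *)
Lemma sgmulS h s : sgmul S h.+1 s <->
  exists m t, [/\ sgmax S m, sgmul S h t & s = (m + t)%N].
Proof.
split.
  case: h => [|h] [m [Mm ->]]; exists (m ord0).
    by exists 0%N; rewrite big_ord1 addn0; split=> //; exact: sgset0.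
  exists (\sum_(i < h.+1) m (lift ord0 i))%N.
  split=> //; last exact: big_ord_recl.
  by exists (fun i => m (lift ord0 i)).
case=> m [t [Mm ht ->]]; case: h ht => [|h].
  move=> /= St; exists (fun=> (m + t)%N); split; last by rewrite big_ord1.
  move=> _; case: Mm => Sm /= m0; split; first exact: sgsetD.
  by move=> /eqP; rewrite addn_eq0 => /andP[/eqP/m0].
case=> f [Mf ->]; exists (fun i => if unlift ord0 i is Some j then f j else m).
split; first by move=> i; case: unliftP.
rewrite [RHS]big_ord_recl unlift_none; congr (_ + _)%N.
by apply: eq_bigr => i _; rewrite liftK.
Qed.

Lemma sgmul1 s : sgmul S 1 s <-> sgmax S s.
Proof.
split; first by case=> m [Mm ->]; rewrite big_ord1.
by move=> Ms; exists (fun=> s); rewrite big_ord1.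
Qed.

Lemma sgmulD h k s t : sgmul S h s -> sgmul S k t -> sgmul S (h + k) (s + t)%N.
Proof.
move=> + kt; elim: h s => [|h IH] s.
  rewrite add0n => Ss; elim: k t kt => [|k IH] t; first exact: sgsetD.
  move=> /sgmulS [m [t' [Mm kt' ->]]]; apply/sgmulS.
  by exists m, (s + t')%N; split=> //; [exact: IH | rewrite addnCA].
move=> /sgmulS [m [s' [Mm hs' ->]]]; apply/sgmulS.
by exists m, (s' + t)%N; split=> //; [exact: IH | rewrite addnA].
Qed.

Lemma sgmul_anti h k : (h <= k)%N -> sgmul S k `<=` sgmul S h.
Proof.
elim: h k => [|h IH] [|k] // hk s //.
  by case=> f [Mf ->]; elim/big_ind: _ => // [|x y|i _];
    [exact: sgset0 | exact: sgsetD | case: (Mf i)].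
move=> /sgmulS [m [t [Mm kt ->]]]; apply/sgmulS; exists m, t; split=> //.
exact: IH kt.
Qed.

Lemma sgmulMn h x : sgmax S x -> sgmul S h (h * x)%N.
Proof.
move=> Mx; elim: h => [|h IH]; first exact: sgset0.
by rewrite mulSn; apply/sgmulS; exists x, (h * x)%N.
Qed.

Lemma sgmul_leq h s : sgmul S h s -> (h <= s)%N.
Proof.
elim: h s => // h IH s /sgmulS [m [t [[_ /= m0] /IH ht ->]]]; lia.
Qed.

(** A sum of [k] nonzero naturals is at least [k], so only finitely many of the
    sets [kM] contain a given [s]; the last one determines its layer. *)
Lemma sgmul_order h s : sgmul S h s ->
  exists2 k, (h <= k)%N & layer S k s.
Proof.
move=> hs; have exk : exists k, `[< sgmul S k s >] by exists h; apply/asboolP.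
case: (@ex_maxnP _ s exk) => [k /asboolP/sgmul_leq //|k /asboolP ks kmax].
exists k; first by apply: kmax; apply/asboolP.
by split=> // /asboolP/kmax; rewrite ltnn.
Qed.

End Powers.

(** * Injecting a layer into the next one *)

Section Tangent.
Variables (S : semigroupN) (g1 : nat).
Hypotheses (Mg1 : sgmax S g1) (minM : forall m, sgmax S m -> (g1 <= m)%N).
Local Notation C := (sgC S g1).
Local Notation L := (layer S).

Lemma sgmul_ge_min h s : sgmul S h.+1 s -> (g1 <= s)%N.
Proof. by move=> /sgmulS [m [t [/minM g1m _ ->]]]; lia. Qed.

(** The monomials of the tangent cone that survive modulo the initial form of
    [t^g1] are closed under taking factors. If [u] were in
    [(h+2)M], adding [v] would raise the order of [u + v]; if [u - g1] were in
    [hM], adding [v] would put [u + v - g1] in the layer that membership in [C]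
    excludes. *)
Lemma sgC_part h j u v : C (h.+1 + j)%N (u + v)%N ->
  sgmul S h.+1 u -> sgmul S j v -> C h.+1 u.
Proof.
move=> [[_ nC] nD] hu jv.
split; first by split=> // hu'; apply: nC; rewrite -addSn; exact: sgmulD.
move=> [/= hu1 _]; apply: nD.
have := sgmul_ge_min _ _ hu.
have -> : (h.+1 + j).-1 = (h + j)%N by [].
move=> g1u; rewrite -addnBAC //.
split; first exact: sgmulD.
move=> E; apply: nC.
have -> : (u + v = g1 + (u - g1 + v))%N by lia.
by apply/sgmulS; exists g1, (u - g1 + v)%N.
Qed.

(** The order [k + 3] of [s + g1] exceeds the order of [s] by at least two, so
    [s] is not in the layer just below [s + g1]; that is what membership in [C]
    asks for. The case [h = 0] cannot occur, because [g1] is the least element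
    of [M] and hence not in [2M]. *)
Lemma sgC_jump h s : L h s -> sgmul S h.+2 (s + g1)%N ->
  exists2 k, (0 < h <= k.+1)%N & C k.+3 (s + g1)%N.
Proof.
move=> [hs nhs] D.
have h0 : (0 < h)%N.
  case: h hs nhs D => // s0 n1 /sgmulS [m [t [/minM g1m /sgmul1 [_ /= t0] E]]].
  have [s00|/eqP s00] := eqVneq s 0%N; first lia.
  by case: n1; apply/sgmul1.
have [k hk Lk] := sgmul_order _ _ _ D.
case: k hk Lk => [|[|[|k]]] hk Lk; try lia.
exists k; first by rewrite h0 -ltnS.
split=> //; rewrite addnK => -[k1s _]; apply: nhs; apply: sgmul_anti k1s; lia.
Qed.

(** The translates by [g1] of a layer miss [C], which therefore provides free
    room in the next layer. *)
Lemma sgC_shift h s : C h.+1 (s + g1)%N -> ~ L h s.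
Proof. by case=> _; rewrite addnK. Qed.

Lemma layer_shift h s : L h s -> ~ sgmul S h.+2 (s + g1)%N -> L h.+1 (s + g1)%N.
Proof.
move=> [hs _] n; split=> //; rewrite addnC; apply/sgmulS; by exists g1, s.
Qed.

(** Adding an element of [M] raises the order. *)
Lemma layer_incomparable h s m : L h s -> sgmax S m -> ~ L h (m + s)%N.
Proof. by move=> [hs _] Mm [_]; apply; apply/sgmulS; exists m, s. Qed.

(** This negates the bound that is to be proved. *)
Hypothesis few : forall a b c, C 2 a -> C 2 b -> C 2 c ->
  [\/ a = b, a = c | b = c].

Lemma C2_part k x y t : sgmax S x -> sgmax S y -> sgmul S k t ->
  C k.+2 (x + y + t)%N -> C 2 (x + y)%N.
Proof.
move=> Mx My kt Cc; apply: (@sgC_part 1 k _ t) Cc _ kt.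
by apply/sgmulS; exists x, y; split=> //; apply/sgmul1.
Qed.

(** Among any three summands of a decomposition, two are equal: otherwise their
    three pairwise sums would be distinct elements of [C_2]. Moreover two
    different summands [x <> y] cannot both be repeated, since [2x], [x + y]
    and [2y] would be distinct elements of [C_2]. *)
Lemma sgC_shape k c : C k.+3 c ->
  exists x y, [/\ sgmax S x, sgmax S y & c = (k.+2 * x + y)%N].
Proof.
elim: k c => [|k IH] c Cc.
  have [[/sgmulS [x [t [Mx /sgmulS [y [z [My /sgmul1 Mz ->]]] Ec]]] _] _] := Cc.
  have Cxy : C 2 (x + y)%N.
    by apply: (@C2_part 1%N x y z); [| |exact/sgmul1| rewrite -addnA -Ec].
  have Cxz : C 2 (x + z)%N.
    apply: (@C2_part 1%N x z y) => //; first exact/sgmul1.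
    by rewrite -addnA (addnC z) -Ec.
  have Cyz : C 2 (y + z)%N.
    by apply: (@C2_part 1%N y z x); [| |exact/sgmul1| rewrite addnC -Ec].
  have [E|E|E] := few _ _ _ Cxy Cxz Cyz.
  - by exists y, x; split=> //; lia.
  - by exists x, y; split=> //; lia.
  - by exists x, z; split=> //; lia.
have [[/sgmulS [m [t [Mm kt Ec]]] _] _] := Cc.
have [x [y [Mx My Et]]] :
    exists x y, [/\ sgmax S x, sgmax S y & t = (k.+2 * x + y)%N].
  apply: IH; apply: (@sgC_part k.+2 1 t m) => //; last exact/sgmul1.
  by rewrite addn1 addnC -Ec.
have Cxx : C 2 (x + x)%N.
  apply: (@C2_part k.+2 x x (k * x + (y + m))%N) => //.
    rewrite -addn2; apply: sgmulD; first exact: sgmulMn.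
    by apply/sgmulS; exists y, m; split=> //; exact/sgmul1.
  suff <- : c = (x + x + (k * x + (y + m)))%N by []; lia.
have k1 n : sgmax S n -> sgmul S k.+2 (k.+1 * x + n)%N.
  by move=> Mn; rewrite -addn1; apply: sgmulD; [exact: sgmulMn|exact/sgmul1].
have Cxy : C 2 (x + y)%N.
  apply: (@C2_part k.+2 x y (k.+1 * x + m)%N) => //; first exact: k1.
  suff <- : c = (x + y + (k.+1 * x + m))%N by []; lia.
have Cxm : C 2 (x + m)%N.
  apply: (@C2_part k.+2 x m (k.+1 * x + y)%N) => //; first exact: k1.
  suff <- : c = (x + m + (k.+1 * x + y))%N by []; lia.
have [E|E|E] := few _ _ _ Cxx Cxy Cxm.
- by exists x, m; split=> //; lia.
- by exists x, y; split=> //; lia.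
have Cym : C 2 (y + m)%N.
  apply: (@C2_part k.+2 y m (k.+2 * x)%N) => //; first exact: sgmulMn.
  suff <- : c = (y + m + k.+2 * x)%N by []; lia.
have [E'|E'|E'] := few _ _ _ Cxx Cxy Cym.
- by exists x, m; split=> //; lia.
- by exists x, y; split=> //; lia.
- by exists x, y; split=> //; lia.
Qed.

Lemma sgC_double k x y : sgmax S x -> sgmax S y -> C k.+3 (k.+2 * x + y)%N ->
  C 2 (x + x)%N /\ C 2 (x + y)%N.
Proof.
move=> Mx My Cc; split.
  apply: (@C2_part k.+1 x x (k * x + y)%N) => //.
    by rewrite -addn1; apply: sgmulD; [exact: sgmulMn|exact/sgmul1].
  suff <- : (k.+2 * x + y = x + x + (k * x + y))%N by []; lia.
apply: (@C2_part k.+1 x y (k.+1 * x)%N) => //; first exact: sgmulMn.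
suff <- : (k.+2 * x + y = x + y + (k.+1 * x))%N by []; lia.
Qed.

(** If [x + y = 2x'], then [x + x + y = x + x' + x'] is another decomposition of
    a part of the given element, so that [x + x'] joins [2x] and [2x'] in
    [C_2]; these three are distinct unless [x = x']. *)
Lemma sgC_no_switch k x y x' : sgmax S x -> sgmax S y -> sgmax S x' ->
  C k.+3 (k.+2 * x + y)%N -> C 2 (x' + x')%N -> (x + y = x' + x')%N -> x = x'.
Proof.
move=> Mx My Mx' Cc Cxx' E.
have [Cxx _] := sgC_double _ _ _ Mx My Cc.
have Cx' : C 2 (x + x')%N.
  apply: (@C2_part k.+1 x x' (k * x + x')%N) => //.
    by rewrite -addn1; apply: sgmulD; [exact: sgmulMn|exact/sgmul1].
  suff <- : (k.+2 * x + y = x + x' + (k * x + x'))%N by []; lia.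
by have [] := few _ _ _ Cxx Cxx' Cx'; lia.
Qed.

Lemma sgC_truncate h k x y : sgmax S x -> sgmax S y -> (h <= k.+2)%N ->
  C k.+3 (k.+2 * x + y)%N -> C h.+1 (h * x + y)%N.
Proof.
move=> Mx My hk Ck.
apply: (@sgC_part h (k.+2 - h)%N _ ((k.+2 - h) * x)%N); last exact: sgmulMn.
  suff <- : (k.+2 * x + y = h * x + y + (k.+2 - h) * x)%N.
    by have -> : (h.+1 + (k.+2 - h) = k.+3)%N by lia.
  by rewrite addnAC -mulnDl subnKC //; lia.
by rewrite -addn1; apply: sgmulD; [exact: sgmulMn|exact/sgmul1].
Qed.

(** If [x <> x'], then [2x] and [2x'] exhaust [C_2], so both [x + y] and
    [x' + y'] are among them. By [sgC_no_switch] neither can be the double of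
    the other base, which leaves [y = x] and [y' = x'], and the two values are
    then [(h + 2) x] and [(h + 2) x']. *)
Lemma sgC_base_inj h k k' x y x' y' :
  sgmax S x -> sgmax S y -> sgmax S x' -> sgmax S y' ->
  C k.+3 (k.+2 * x + y)%N -> C k'.+3 (k'.+2 * x' + y')%N ->
  (h.+1 * x + y = h.+1 * x' + y')%N -> x = x'.
Proof.
move=> Mx My Mx' My' Cc Cc' E.
have [Cxx Cxy] := sgC_double _ _ _ Mx My Cc.
have [Cxx' Cxy'] := sgC_double _ _ _ Mx' My' Cc'.
have [|E1|E1] := few _ _ _ Cxx Cxx' Cxy; first lia; last first.
  by apply: (sgC_no_switch k _ y); rewrite // -E1.
have [|E2|E2] := few _ _ _ Cxx Cxx' Cxy'; first lia.
  by apply/esym; apply: (sgC_no_switch k' _ y'); rewrite // -E2.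
have exy : y = x by lia.
have exy' : y' = x' by lia.
by move: E; rewrite exy exy' -!mulSnr => /eqP; rewrite eqn_pmul2l // => /eqP.
Qed.

(** Translation by [g1] where it raises the order by exactly one, truncation of
    the shape [(k + 2) x + y] elsewhere. *)
Lemma layer_inj h : exists F : nat -> nat,
  (forall s, L h s -> L h.+1 (F s)) /\
  (forall s s', L h s -> L h s' -> F s = F s' -> s = s').
Proof.
pose jump s t k x y := [/\ (0 < h <= k.+1)%N, sgmax S x /\ sgmax S y,
  C k.+3 (s + g1)%N, (s + g1 = k.+2 * x + y)%N & t = (h * x + y)%N].
pose P s t := t = (s + g1)%N \/ exists k x y, jump s t k x y.
have jumpC s t k x y : jump s t k x y -> C h.+1 t.
  case=> /andP[_ hk] [Mx My] Ck E ->.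
  by apply: (@sgC_truncate _ k) => //; [exact: leqW | rewrite -E].
have /choice [F FP] : forall s, exists t, L h s -> L h.+1 t /\ P s t.
  move=> s; have [Ls|nL] := pselect (L h s); last by exists 0%N.
  have [D|nD] := pselect (sgmul S h.+2 (s + g1)%N); last first.
    by exists (s + g1)%N => _; split; [exact: layer_shift|left].
  have [k hk Ck] := sgC_jump _ _ Ls D.
  have [x [y [Mx My E]]] := sgC_shape _ _ Ck.
  have J : jump s (h * x + y)%N k x y by [].
  exists (h * x + y)%N => _; split; last by right; exists k, x, y.
  by case: (jumpC _ _ _ _ _ J).
exists F; split=> [s /FP []//|s s' Ls Ls' EF].
have [_ PF] := FP _ Ls; have [_] := FP _ Ls'; rewrite -EF.
(* A translate is never equal to a truncation, which lies in [C]. *)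
have noshift r r' t k x y : L h r -> t = (r + g1)%N -> ~ jump r' t k x y.
  by move=> Lr -> /jumpC /sgC_shift.
case: PF => [E|[k [x [y J]]]].
  case=> [E'|[k [x [y J]]]]; first by apply: (@addIn g1); rewrite -E -E'.
  by case: (noshift _ _ _ _ _ _ Ls E J).
case=> [E|[k' [x' [y' J']]]].
  by case: (noshift _ _ _ _ _ _ Ls' E J).
case: J J' => /andP[h0 hk] [Mx My] Ck E Et [_ [Mx' My'] Ck' E' Et'].
have exx : x = x'.
  apply: (sgC_base_inj h.-1 k k' x y x' y') => //; rewrite -?E -?E' //.
  by rewrite (ltn_predK h0) -Et.
subst x'; have eyy : y = y' by lia.
subst y'.
(* With the same [x] and [y], jumping elements differ by a multiple of [x]. *)
have noless r r' i j : L h r -> L h r' -> (r + g1 = i.+2 * x + y)%N ->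
    (r' + g1 = j.+2 * x + y)%N -> ~ (i < j)%N.
  move=> Lr Lr' Ei Ej ij.
  apply: (layer_incomparable _ _ ((j - i) * x)%N Lr).
    split; first exact: (sgmul_anti _ 0 _ (leq0n _) _ (sgmulMn _ (j - i) x Mx)).
    by case: Mx => _ /= x0; nia.
  suff <- : (r' = (j - i) * x + r)%N by [].
  by apply: (@addIn g1); rewrite Ej -addnA Ei; nia.
have ekk : k = k'.
  case: (ltngtP k k') => //; first by move/(noless _ _ _ _ Ls Ls' E E').
  by move/(noless _ _ _ _ Ls' Ls E' E).
by apply: (@addIn g1); rewrite E E' ekk.
Qed.

End Tangent.

(** * Minimal generators *)

Section Generators.
Variables (S : semigroupN) (g : seq nat).
Hypotheses (genS : generated g = S) (g0 : 0%N \notin g).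

Lemma generator_mem x : x \in g -> sgmax S x.
Proof.
move=> gx; split; last by move=> /= x0; rewrite x0 (negPf g0) in gx.
have ix : (index x g < size g)%N by rewrite index_mem.
rewrite -genS; exists (fun i => (i == index x g) : nat).
rewrite (bigD1 (Ordinal ix)) //= eqxx mul1n nth_index // big1 ?addn0 // => i.
by rewrite -val_eqE /= => /negPf ->.
Qed.

(** Some generator has a nonzero coefficient in [s]: split off one copy. *)
Lemma sgmax_split s : sgmax S s -> exists i t,
  [/\ (i < size g)%N, sgset S t & s = (nth 0%N g i + t)%N].
Proof.
case; rewrite -{1}genS => -[a Es] /= s0.
have [i ai0] : exists i : 'I_(size g), a i != 0%N.
  apply: contrapT => /forallNP all0; apply: s0; rewrite Es big1 // => i _.
  by have /negP := all0 i; rewrite negbK => /eqP ->.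
exists i, (\sum_(j < size g) (a j - (j == i)) * nth 0 g j)%N; split=> //.
  rewrite -genS; exists (fun j => a j - (j == i))%N; by [].
rewrite Es (bigD1 i) // [in RHS](bigD1 i) //= eqxx addnA -mulSn subn1.
rewrite prednK ?lt0n //.
by congr (_ + _)%N; apply: eq_bigr => j /negPf ji; rewrite ji subn0.
Qed.

Lemma sgmulS_split h s : sgmul S h.+1 s -> exists i t,
  [/\ (i < size g)%N, sgmul S h t & s = (nth 0%N g i + t)%N].
Proof.
move=> /sgmulS [m [t [/sgmax_split [i [t' [ig St' ->]]] ht ->]]].
exists i, (t' + t)%N; split=> //; last by rewrite addnA.
by rewrite -[h]add0n; exact: sgmulD.
Qed.

(** An element of [hM] outside [(h+1)M] is a sum of at most [h] generators, each
    of them at most the sum of all generators. *)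
Lemma layer_bounded h s : layer S h s -> (s <= h * sumn g)%N.
Proof.
elim: h s => [|h IH] s [hs nhs].
  rewrite mul0n leqNgt; apply/negP => s0; apply: nhs; apply/sgmul1; split=> //.
  by move=> /= E; rewrite E in s0.
have /sgmulS_split [i [t [ig ht E]]] := hs.
have Mi : sgmax S (nth 0%N g i) by apply: generator_mem; exact: mem_nth.
rewrite E mulSn leq_add //.
  by rewrite sumnE (big_nth 0%N) big_mkord (bigD1 (Ordinal ig)) //= leq_addr.
apply: IH; split=> // ht'; apply: nhs; rewrite E.
by apply/sgmulS; exists (nth 0%N g i), t.
Qed.

End Generators.

(** * Invariance of the dimension of a quotient *)

Local Open Scope ring_scope.

Section QuotientBasis.
Variables (K : fieldType) (V : lmodType K) (U W : set V).
Hypotheses (W0 : W 0) (Wlin : forall a u v, W u -> W v -> W (a *: u + v)).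

Lemma closed_sum_scale d (a : 'I_d -> K) (v : 'I_d -> V) :
  (forall i, W (v i)) -> W (\sum_i a i *: v i).
Proof.
move=> Wv; elim/big_rec: _ => // i x _ Wx; exact: Wlin.
Qed.

(** Invariance of dimension: the two change-of-basis matrices multiply to the
    identity, by uniqueness of coordinates. *)
Lemma quot_basis_leq d d' (b : 'I_d -> V) (b' : 'I_d' -> V) :
  quot_basis U W b -> quot_basis U W b' -> (d <= d')%N.
Proof.
move=> [Ub b_uniq] [Ub' b'_uniq].
have /choice [A WA] : forall i, exists c : {ffun 'I_d' -> K},
    W (b i - \sum_j c j *: b' j).
  by move=> i; have [c [Wc _]] := b'_uniq _ (Ub i); exists c.
have /choice [B WB] : forall j, exists c : {ffun 'I_d -> K},
    W (b' j - \sum_k c k *: b k).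
  by move=> j; have [c [Wc _]] := b_uniq _ (Ub' j); exists c.
suff : (\matrix_(i, j) A i j) *m (\matrix_(j, k) B j k) = 1%:M.
  exact: mulmx1_min.
apply/matrixP => i k; rewrite !mxE.
have [c [_ c_uniq]] := b_uniq _ (Ub i).
transitivity (c k); last first.
  rewrite (c_uniq [ffun k => (i == k)%:R]) ?ffunE //.
  rewrite (bigD1 i) //= ffunE eqxx scale1r big1 ?addr0 ?subrr // => l.
  by rewrite eq_sym ffunE => /negPf ->; rewrite scale0r.
rewrite (c_uniq [ffun k => \sum_j A i j * B j k]).
  by rewrite ffunE; apply: eq_bigr => j _; rewrite !mxE.
have := Wlin 1 _ _ (closed_sum_scale _ (A i) _ WB) (WA i).
rewrite scale1r; congr (W _).
rewrite addrC -addrA; congr (_ + _).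
rewrite -sumrN -big_split /=.
rewrite (eq_bigr (fun j => - (A i j *: \sum_k B j k *: b k))).
  rewrite sumrN; congr (- _).
  rewrite (eq_bigr (fun j => \sum_k (A i j * B j k) *: b k)) => [|j _].
    rewrite exchange_big /=; apply: eq_bigr => l _.
    by rewrite ffunE scaler_suml.
  by rewrite scaler_sumr; apply: eq_bigr => l _; rewrite scalerA.
by move=> j _; rewrite scalerBr addKr.
Qed.

Lemma quot_dimE d (b : 'I_d -> V) : quot_basis U W b -> quot_dim U W = d.
Proof.
move=> Ub; apply: xget_unique; first by exists b.
move=> d' [b' Ub']; apply/eqP; rewrite eqn_leq.
by rewrite (quot_basis_leq _ _ _ _ Ub' Ub) (quot_basis_leq _ _ _ _ Ub Ub').
Qed.

End QuotientBasis.

(** * The Hilbert function counts the layers *)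

Section Hilbert.
Variables (K : fieldType) (S : semigroupN) (g : seq nat).
Hypotheses (genS : generated g = S) (g0 : 0%N \notin g).
Local Notation R := (sgring K S).

Definition supported (A : set nat) : set R :=
  [set f | forall n, ~ A n -> fps_coef f n = 0].

Lemma supported0 A : supported A 0.
Proof. by []. Qed.

Lemma supportedD A (f f' : R) :
  supported A f -> supported A f' -> supported A (f + f').
Proof. by move=> Af Af' n nA; rewrite /= Af // Af' // addr0. Qed.

Lemma supported_lin A a (f f' : R) :
  supported A f -> supported A f' -> supported A (a *: f + f').
Proof. by move=> Af Af' n nA; rewrite /= Af // Af' // mulr0 addr0. Qed.

Lemma supportedM (A B D : set nat) (f f' : R) :
  (forall s t, A s -> B t -> D (s + t)%N) ->
  supported A f -> supported B f' -> supported D (f * f').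
Proof.
move=> ABD Af Bf' n nD /=; apply: big1 => i _.
have [Ai|/Af ->] := pselect (A i); last by rewrite mul0r.
have [Bi|/Bf' ->] := pselect (B (n - i)%N); last by rewrite mulr0.
by case: nD; rewrite -(@subnKC i n) -1?ltnS //; exact: ABD.
Qed.

Lemma supported_series (A : set nat) (f : nat -> K) : A `<=` S ->
  (forall n, ~ A n -> f n = 0) ->
  exists2 u : R, supported A u & fps_coef u =1 f.
Proof.
move=> AS Af; have Sf : FPS f \in supported_in S.
  by apply/asboolP => n nS /=; apply: Af => /AS.
by exists (Sgring Sf).
Qed.

Lemma sgring_monomial s : sgset S s ->
  exists u : R, sgring_val u = fps_monomial K s.
Proof.
move=> Ss.
have [||u _ Eu] := @supported_series [set s] (fun n => (n == s)%:R).
- by move=> _ ->.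
- by move=> n /eqP /negPf ->.
by exists u; exact: fpsP.
Qed.

Lemma coef_fps_monomialM s (f : fps K) n :
  fps_coef (fps_monomial K s * f) n =
  if (s <= n)%N then fps_coef f (n - s) else 0.
Proof.
rewrite /=; case: leqP => sn.
  have sn' : (s < n.+1)%N by [].
  rewrite (bigD1 (Ordinal sn')) //= eqxx mul1r big1 ?addr0 // => i.
  by rewrite -val_eqE /= => /negPf ->; rewrite mul0r.
by apply: big1 => i _; rewrite ltn_eqF ?mul0r // (leq_trans (ltn_ord i)).
Qed.

Lemma coef_sgringM (u v : R) n :
  fps_coef (u * v : R) n = fps_coef (sgring_val u * sgring_val v) n.
Proof. by []. Qed.

Lemma coef_sum d (u : 'I_d -> R) n :
  fps_coef (\sum_i u i : R) n = \sum_i fps_coef (u i) n.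
Proof. by elim/big_rec2: _ => // i p q _ <-. Qed.

Lemma supported_sum A n (u : 'I_n -> R) :
  (forall i, supported A (u i)) -> supported A (\sum_i u i).
Proof.
move=> Au; elim/big_rec: _ => [|i x _ Ax]; first exact: supported0.
exact: supportedD.
Qed.

Lemma sgring_max_supported : @sgring_max K S g `<=` supported (sgmul S 1).
Proof.
move=> _ [n [r [y [gy ->]]]]; apply: supported_sum => i.
apply: (@supportedM S (sgmul S 1)) => [s t Ss Mt||].
- by apply: (@sgmulD _ 0 1).
- by have /asboolP := sgring_valP (r i).
have [s sg Ey] := gy i; move=> m nm; rewrite Ey /=.
case: eqP => // E; case: nm; rewrite E; apply/sgmul1; exact: generator_mem sg.
Qed.

(** A series supported in [(h+1)M] is split according to a choice, for every
    exponent [n] in [(h+1)M], of a generator [g_i] with [n - g_i] in [hM];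
    dividing the [i]-th piece by [t^g_i] gives a series supported in [hM]. *)
Lemma ideal_powE h :
  ideal_pow (@sgring_max K S g) h = supported (sgmul S h).
Proof.
elim: h => [|h IH].
  by apply/seteqP; split=> // f _; have /asboolP := sgring_valP f.
rewrite /ideal_pow iterS -/(ideal_pow _ h) IH; apply/seteqP; split.
  move=> _ [n [r [y [Iy ->]]]]; apply: supported_sum => i.
  have [u [v [/sgring_max_supported Mu hv ->]]] := Iy i.
  apply: (@supportedM S (sgmul S h.+1)) => [s t Ss Mt||].
  - by apply: (@sgmulD _ 0 h.+1).
  - by have /asboolP := sgring_valP (r i).
  by apply: supportedM Mu hv => s t Ms ht; exact: (@sgmulD _ 1 h).
move=> f hf.
have /choice [c hc] : forall n, exists i, sgmul S h.+1 n ->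
    (i < size g)%N /\ exists2 t, sgmul S h t & n = (nth 0%N g i + t)%N.
  move=> n; have [/(sgmulS_split _ _ genS)|nn] := pselect (sgmul S h.+1 n).
    by case=> i [t [ig ht E]]; exists i => _; split=> //; exists t.
  by exists 0%N.
have Sg (i : 'I_(size g)) : sgset S (nth 0%N g i).
  by have [] := generator_mem _ _ genS g0 _ (mem_nth 0%N (ltn_ord i)).
have /choice [x xP] : forall i : 'I_(size g), exists x : R,
   sgring_val x = fps_monomial K (nth 0%N g i).
  by move=> i; exact: sgring_monomial.
have /choice [y yP] : forall i : 'I_(size g), exists y : R,
   supported (sgmul S h) y /\ fps_coef y =1 fun n => if c (n + nth 0 g i)%N == i
                          then fps_coef f (n + nth 0 g i) else 0.
  move=> i; have [||u hu Eu] := @supported_series (sgmul S h)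
    (fun n => if c (n + nth 0 g i)%N == i
              then fps_coef f (n + nth 0 g i) else 0).
  - exact: (@sgmul_anti _ 0 h).
  - move=> n nn; case: eqP => // ci; apply: hf => /hc [_ [t ht]].
    by rewrite ci addnC => /addnI E; apply: nn; rewrite E.
  by exists u.
exists (size g), (fun=> 1), (fun i => x i * y i); split.
  move=> i; exists (x i), (y i); split=> //; last by case: (yP i).
  exists 1%N, (fun=> 1), (fun=> x i); rewrite big_ord1 mul1r; split=> // _.
  by exists (nth 0%N g i) => //; exact: mem_nth.
apply: val_inj; apply: fpsP => n; rewrite /= coef_sum.
under eq_bigr => i _ do rewrite mul1r coef_sgringM xP coef_fps_monomialM.
have [/[dup] hn /hc [cg [t ht En]]|nn] := pselect (sgmul S h.+1 n); last first.
  rewrite hf // big1 // => i _; case: leqP => // gn.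
  by rewrite (yP i).2 subnK // hf // if_same.
have gn : (nth 0 g (c n) <= n)%N by rewrite {2}En leq_addr.
rewrite (bigD1 (Ordinal cg)) //= gn (yP _).2 /= subnK //.
rewrite eqxx big1 ?addr0 // => i ic; case: leqP => // gi.
rewrite (yP i).2 subnK //; case: eqP => // E.
by case/eqP: ic; apply: val_inj; rewrite /= E.
Qed.

Definition layer_seq h : seq nat :=
  [seq s <- iota 0 (h * sumn g).+1 | `[< layer S h s >]].

Lemma mem_layer_seq h s : (s \in layer_seq h) = `[< layer S h s >].
Proof.
rewrite mem_filter mem_iota; case: asboolP => //= /(layer_bounded _ _ genS g0).
by rewrite add0n ltnS => ->.
Qed.

Lemma layer_seq_uniq h : uniq (layer_seq h).
Proof. by rewrite filter_uniq // iota_uniq. Qed.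

(** The monomials with exponents in the layer form a basis of the quotient:
    the exponents in [(h+1)M] vanish modulo the denominator, and the remaining
    coefficients are the coordinates. *)
Lemma hilbertE h : hilbert K S g h = size (layer_seq h).
Proof.
rewrite /hilbert !ideal_powE.
have mem_s (i : 'I_(size (layer_seq h))) :
    layer S h (nth 0%N (layer_seq h) i).
  by apply/asboolP; rewrite -mem_layer_seq mem_nth.
have /choice [b bP] : forall i : 'I_(size (layer_seq h)), exists b : R,
    sgring_val b = fps_monomial K (nth 0%N (layer_seq h) i).
  move=> i; apply: sgring_monomial.
  by apply: (@sgmul_anti _ 0 h) => //; case: (mem_s i).
have coefB (v : R) (c : {ffun 'I_(size (layer_seq h)) -> K}) n :
    fps_coef (v - \sum_i c i *: b i : R) n =
    fps_coef v n - \sum_i c i * (n == nth 0%N (layer_seq h) i)%:R.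
  rewrite [LHS]/= coef_sum; congr (_ - _).
  by apply: eq_bigr => i _; rewrite -[LHS]/(c i * fps_coef (b i) n) bP.
have coef_at (c : {ffun 'I_(size (layer_seq h)) -> K})
    (i : 'I_(size (layer_seq h))) :
   \sum_j c j * (nth 0%N (layer_seq h) i == nth 0%N (layer_seq h) j)%:R = c i.
  rewrite (bigD1 i) //= eqxx mulr1 big1 ?addr0 // => j /negPf ji.
  by rewrite nth_uniq ?layer_seq_uniq // eq_sym val_eqE ji mulr0.
apply: (@quot_dimE _ _ _ _ _ _ _ b).
- exact: supported0.
- by move=> *; exact: supported_lin.
split=> [i n nn|v hv].
  rewrite bP /=; case: eqP => // E; case: nn; rewrite E; by case: (mem_s i).
exists [ffun i : 'I_(size (layer_seq h)) =>
          fps_coef v (nth 0%N (layer_seq h) i)]; split=> [n nn|c Wc].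
  have [hn|nhn] := pselect (sgmul S h n).
    have ln : n \in layer_seq h by rewrite mem_layer_seq; apply/asboolP.
    move: (ln); rewrite -index_mem => il.
    rewrite coefB -{2}(nth_index 0%N ln) (coef_at _ (Ordinal il)) ffunE /=.
    by rewrite nth_index // subrr.
  rewrite coefB hv // big1 ?subrr // => i _.
  case: eqP => [E|_]; last by rewrite mulr0.
  by case: nhn; rewrite E; case: (mem_s i).
apply/ffunP => i; rewrite ffunE; apply/eqP; rewrite -subr_eq0; apply/eqP.
have := Wc (nth 0%N (layer_seq h) i); rewrite coefB coef_at; apply.
by case: (mem_s i).
Qed.

End Hilbert.

Local Close Scope ring_scope.

(** * From layers to a decreasing Hilbert function *)

Section MinimalGenerators.
Variables (S : semigroupN) (g : seq nat).
Hypotheses (genS : minimal_generators S g).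

(** Dropping a zero from a list of generators does not change what it
    generates. *)
Lemma minimal_generators_neq0 : 0%N \notin g.
Proof.
have [sg gS gmin] := genS.
case: g sg gS gmin => // x g' sg gS gmin; apply/negP => g0.
have x0 : x = 0%N.
  move: g0; rewrite inE => /orP [/eqP //|].
  by have /allP /[apply] := order_path_min ltn_trans sg.
have := gmin g' (subseq_cons _ _); rewrite -{}gS x0 => /(_ _) E.
suff /E /(congr1 size) /eqP : generated g' = generated (0%N :: g').
  by rewrite /= ltn_eqF.
apply/seteqP; split=> s [a ->].
  exists (fun i => if i is j.+1 then a j else 0%N).
  by rewrite [RHS]big_ord_recl /= muln0 add0n.
by exists (fun i => a i.+1); rewrite [LHS]big_ord_recl /= muln0 add0n.
Qed.

Lemma head_min m : sgmax S m -> (head 0%N g <= m)%N.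
Proof.
have [sg gS _] := genS.
move=> /(sgmax_split _ _ gS) [i [t [ig _ ->]]]; apply: leq_trans (leq_addr _ _).
case: g sg ig => // x g' /= sg; case: i => //= i ig.
by have /allP /(_ _ (mem_nth 0%N ig)) /ltnW := order_path_min ltn_trans sg.
Qed.

End MinimalGenerators.

Lemma card_ge3 (A : set nat) a b c : A a -> A b -> A c ->
  a <> b -> a <> c -> b <> c -> `I_3 #<= A.
Proof.
move=> Aa Ab Ac ab ac bc; apply/pcard_leP/injfunPex.
exists (fun i => nth 0%N [:: a; b; c] i); first by case=> [|[|[]]].
move=> i j /set_mem /= i3 /set_mem /= j3 /eqP; rewrite nth_uniq //.
  by move/eqP.
by rewrite /= !inE !negb_or; do ![case: eqP => //].
Qed.

Theorem proposition2p9 (K : fieldType) (S : semigroupN) (g : seq nat)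
    (infK : infinite_set [set: K])
    (genS : minimal_generators S g)
    (gcd1 : gcd_seq g = 1%N)
    (decH : exists2 h : nat,
       (1 <= h)%N & (hilbert K S g h < hilbert K S g h.-1)%N) :
  exists2 j : nat, (2 <= j)%N &
    forall h : nat, (2 <= h <= j)%N -> `I_h.+1 #<= sgC S (head 0%N g) h.
Proof.
exists 2%N => // h h2; have -> : h = 2%N by lia.
apply: contrapT => small.
have few a b c : sgC S (head 0%N g) 2 a -> sgC S (head 0%N g) 2 b ->
    sgC S (head 0%N g) 2 c -> [\/ a = b, a = c | b = c].
  move=> Ca Cb Cc.
  have [ab|ab] := pselect (a = b); first by constructor 1.
  have [ac|ac] := pselect (a = c); first by constructor 2.
  have [bc|bc] := pselect (b = c); first by constructor 3.
  by case: small; exact: card_ge3 Ca Cb Cc ab ac bc.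
have g0 := minimal_generators_neq0 _ _ genS.
have [_ gS _] := genS.
have Mg1 : sgmax S (head 0%N g).
  apply: (generator_mem _ _ gS g0).
  by case: g gcd1 {decH genS small few g0 gS} => [|x g' _];
    [rewrite /gcd_seq big_nil | exact: mem_head].
case: decH => -[//|k] _; rewrite !(hilbertE _ _ _ gS g0) ltnNge => /negP; apply.
have [F [FL Finj]] := layer_inj _ _ Mg1 (head_min _ _ genS) few k.
rewrite -(size_map F) uniq_leq_size //.
  rewrite map_inj_in_uniq ?layer_seq_uniq // => s s'.
  rewrite !(mem_layer_seq _ _ gS g0) => /asboolP Ls /asboolP Ls'; exact: Finj.
move=> _ /mapP [s + ->]; rewrite !(mem_layer_seq _ _ gS g0) => /asboolP Ls.
by apply/asboolP/FL.
Qed.
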